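(* Let $T$ be an invertible $n\times n$ real Toeplitz matrix and let $\mathbf{u}=(u_1,\ldots,u_{n+1})^T\in\mathbb{R}^{n+1}$ be a vector with $u_1\neq 0$ and $u_{n+1}\neq 0$. If $\mathbf{u}$ belongs to the kernel of $\partial T$, then for all integers $k\ge l$ and $s\ge t$ the extended matrix $\mathcal{T}[T:k,l;s,t]$ (formed with the companion matrices of $\mathbf{u}$) is Toeplitz.
   Context: For $\mathbf{u}=(u_1,\ldots,u_{n+1})^T\in\mathbb{R}^{n+1}$ with $u_1,u_{n+1}\neq 0$, define the nonsingular $n\times n$ companion matrices: $C_t$: first row $\left(-\frac{u_n}{u_{n+1}},-\frac{u_{n-1}}{u_{n+1}},\ldots,-\frac{u_1}{u_{n+1}}\right)$; rows $2,\ldots,n$ are $[\,I_{n-1}\;\;0\,]$. $C_r$: columns $1,\ldots,n-1$ are $\begin{bmatrix}0\\ I_{n-1}\end{bmatrix}$; last column $\left(-\frac{u_1}{u_{n+1}},-\frac{u_2}{u_{n+1}},\ldots,-\frac{u_n}{u_{n+1}}\right)^T$. For an $n\times n$ Toeplitz matrix $T=(a_{i-j})_{i,j=1}^n$, $\partial T$ is the $(n-1)\times(n+1)$ Toeplitz matrix with entries $(\partial T)_{ij}=a_{i-j+1}$, $1\le i\le n-1$, $1\le j\le n+1$. Extensions: for an $n\times n$ matrix $A$ and integers $k\ge l$, $\mathcal{T}[A:k,l]$ is the $(n+k-l)\times n$ matrix $$\mathcal{T}[A:k,l]=\begin{bmatrix}\gamma_{k-l}\\ \vdots\\ \gamma_1\\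 C_t^lA\end{bmatrix},$$ where $\gamma_i$ ($i=1,\ldots,k-l$) is the first row of $C_t^{l+i}A$. For integers $s\ge t$, $\mathcal{T}[A:k,l;s,t]$ is the $(n+k-l)\times(n+s-t)$ matrix $$\mathcal{T}[A:k,l;s,t]=\begin{bmatrix}\mathcal{T}[A:k,l]\,C_r^t&\beta_1&\cdots&\beta_{s-t}\end{bmatrix},$$ where $\beta_i$ ($i=1,\ldots,s-t$) is the last column of $\mathcal{T}[A:k,l]\,C_r^{t+i}$. Here negative powers are powers of the inverse. A (possibly rectangular) matrix is Toeplitz if its $(i,j)$ entry depends only on $i-j$. *)

(* Defs.v *)
From HB Require Import structures.
From mathcomp Require Import all_boot all_order all_algebra.
From mathcomp Require Import zify.
Set Implicit Arguments.
Unset Strict Implicit.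
Unset Printing Implicit Defensive.
Import Order.TTheory GRing.Theory Num.Theory.
Local Open Scope ring_scope.

(* Everything is indexed from 0, and the order of the square matrices is n.+1,
   so that their integer powers live in a unit ring.  Thus the vector
   (u_1, ..., u_{N+1}) with N = n.+1 is u : 'cV_n.+2, and u_i is u (i-1) 0. *)

Definition is_toeplitz (R : Type) (m n : nat) (A : 'M[R]_(m, n)) : Prop :=
  forall (i i' : 'I_m) (j j' : 'I_n),
    i%:Z - j%:Z = i'%:Z - j'%:Z -> A i j = A i' j'.

(* For a Toeplitz matrix T = (a_{i-j}), the coefficient a_d, |d| <= n, read off
   the first column (d >= 0) or the first row (d <= 0) of T. *)
Definition toeplitz_coef (R : Type) (n : nat) (T : 'M[R]_n.+1) (d : int) : R :=
  if 0 <= d then T (inord `|d|%N) ord0 else T ord0 (inord `|d|%N).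

Definition dtoeplitz (R : Type) (n : nat) (T : 'M[R]_n.+1) : 'M[R]_(n, n.+2) :=
  \matrix_(i < n, j < n.+2) toeplitz_coef T (i%:Z - j%:Z + 1).

Lemma dtoeplitzE (R : Type) (n : nat) (T : 'M[R]_n.+1) (a : int -> R) :
  (forall i j, T i j = a (i%:Z - j%:Z)) ->
  forall i j, dtoeplitz T i j = a (i%:Z - j%:Z + 1).
Proof.
move=> Ta i j; rewrite mxE /toeplitz_coef.
have le_n : (`|(i%:Z - j%:Z + 1)%R|%N < n.+1)%N.
  by have := ltn_ord i; have := ltn_ord j; lia.
by case: ifP => d0; rewrite Ta inordK //; congr (a _); rewrite /=; lia.
Qed.

Section Extensions.
Variables (R : fieldType) (n : nat).
Implicit Types (u : 'cV[R]_n.+2) (A : 'M[R]_n.+1) (k l s t : int).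

Definition companion_top u : 'M[R]_n.+1 :=
  \matrix_(i < n.+1, j < n.+1)
    if i == ord0 then - (u (inord (n - j)) ord0 / u ord_max ord0)
    else (i == j.+1 :> nat)%:R.

Definition companion_right u : 'M[R]_n.+1 :=
  \matrix_(i < n.+1, j < n.+1)
    if j == ord_max then - (u (inord i) ord0 / u ord_max ord0)
    else (i == j.+1 :> nat)%:R.

(* Both extensions are meaningful only for l <= k and t <= s, where the absolute
   values are the plain differences.  Row p of the upper block is gamma_(k-l-p),
   and column q of the right block is beta_(q+1). *)
Definition row_extension u A k l : 'M[R]_(`|(k - l)%R|%N + n.+1, n.+1) :=
  col_mx
    (\matrix_(p < `|(k - l)%R|%N)
       row ord0 (companion_top u ^ (l + (`|(k - l)%R| - p)%N%:Z) *m A))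
    (companion_top u ^ l *m A).

Definition extension u A k l s t :
    'M[R]_(`|(k - l)%R|%N + n.+1, n.+1 + `|(s - t)%R|%N) :=
  row_mx
    (row_extension u A k l *m companion_right u ^ t)
    (\matrix_(i < `|(k - l)%R|%N + n.+1, q < `|(s - t)%R|%N)
       (row_extension u A k l *m companion_right u ^ (t + q.+1%:Z)) i ord_max).

End Extensions.

(* Main.v *)
Require Import Defs.
From HB Require Import structures.
From mathcomp Require Import all_boot all_order all_algebra.
From mathcomp Require Import zify.
From mathcomp Require Import reals.
Set Implicit Arguments.
Unset Strict Implicit.
Unset Printing Implicit Defensive.
Import Order.TTheory GRing.Theory Num.Theory.
Local Open Scope ring_scope.

(** Write [Ct], [Cr] for the two companion matrices of [u] and [T = (a_(i-j))].
    Left multiplication by [Ct] moves the rows of a matrix down by one, and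
    right multiplication by [Cr] moves its columns left by one; each inserts
    one new line, computed by the linear recurrence with coefficients [u].  The
    hypothesis [dtoeplitz T *m u = 0] says that the [a_d] obey this very
    recurrence, so on [T] both operations continue the diagonals of [T] and
    give the matrix [(a_(i-j-1))], except at the top right corner, which would
    be the still undefined [a_(-n-1)].  There both insert the same value
    predicted by the recurrence.  Hence [Ct T = T Cr]
    ([companion_intertwining]).

    Consequently [Ct^x T Cr^y = Ct^(x+y) T] for all integers [x] and [y], and
    each extension is made of entries of the matrices [Ct^z T].  In these, going
    down one row lowers [z] by one, because of the shape of [Ct], and going
    right one column raises [z] by one, because column [j+1] of [T] is [Ct]
    times its column [j].  So all of these entries belong to the one sequence
    [z |-> (Ct^z T)_(0,0)] ([orbit_entryE]), and the exponent met at position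
    [(i, j)] of the extension is a constant plus [j - i] ([extensionE]). *)

(** * Toeplitz coefficients and the recurrence given by the kernel vector *)

Lemma toeplitz_coefE (R : Type) (n : nat) (T : 'M[R]_n.+1) :
  is_toeplitz T -> forall i j, T i j = toeplitz_coef T (i%:Z - j%:Z).
Proof.
move=> T_toep i j; rewrite /toeplitz_coef.
have := ltn_ord i; have := ltn_ord j => ltj lti.
by case: ifP => d0; apply: T_toep; rewrite inordK /=; lia.
Qed.

Section Companion.
Variables (F : fieldType) (n : nat).
Implicit Types (u : 'cV[F]_n.+2) (A T : 'M[F]_n.+1) (a : int -> F).

(** The value of [a d] for which [u] annihilates the window
    [a (d + n + 1), ..., a d]. *)
Definition recurrence_value u a (d : int) : F :=
  - (\sum_(p < n.+1) u (inord p) ord0 * a (d + n.+1%:Z - p%:Z)) / u ord_max ord0.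

Lemma kernel_recurrence u T a :
    (forall i j, T i j = a (i%:Z - j%:Z)) -> u ord_max ord0 != 0 ->
    dtoeplitz T *m u = 0 ->
  forall d : int, - n%:Z <= d -> d < 0 -> recurrence_value u a d = a d.
Proof.
move=> Ta u_last u_ker d ged ltd.
have lt_i : (`|(d + n%:Z)%R|%N < n)%N by lia.
have := congr1 (fun M : 'cV_n => M (Ordinal lt_i) ord0) u_ker.
rewrite !mxE big_ord_recr /= (dtoeplitzE Ta) /=.
have -> : `|(d + n%:Z)%R|%N%:Z - n.+1%:Z + 1 = d by lia.
rewrite /recurrence_value.
under eq_bigr => p _.
  rewrite (dtoeplitzE Ta) /= mulrC.
  have -> : widen_ord (leqnSn n.+1) p = inord p.
    by apply: val_inj; rewrite /= inordK // ltnW // ltnS ltn_ord.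
  have -> : `|(d + n%:Z)%R|%N%:Z - p%:Z + 1 = d + n.+1%:Z - p%:Z by lia.
  over.
by move/eqP; rewrite addr_eq0 => /eqP ->; rewrite opprK mulfK.
Qed.

(** * The companion matrices as shifts *)

Lemma companion_top_mul_below u A (i i' : 'I_n.+1) j :
  i = i'.+1 :> nat -> (companion_top u *m A) i j = A i' j.
Proof.
move=> ii'; rewrite mxE (bigD1 i') //= big1 => [|p ne_p]; rewrite !mxE.
  by rewrite -(inj_eq val_inj) /= ii' /= eqxx mul1r addr0.
rewrite -(inj_eq val_inj) /= ii' /= eqSS.
by rewrite eq_sym val_eqE (negbTE ne_p) mul0r.
Qed.

Lemma mul_companion_right_before u A i (j j' : 'I_n.+1) :
  j' = j.+1 :> nat -> (A *m companion_right u) i j = A i j'.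
Proof.
move=> jj'; have j_neq : (j == ord_max) = false.
  by apply/negP=> /eqP j_max; have := ltn_ord j'; rewrite jj' j_max ltnn.
rewrite mxE (bigD1 j') //= big1 => [|p ne_p]; rewrite !mxE j_neq.
  by rewrite jj' eqxx mulr1 addr0.
by rewrite -jj' val_eqE (negbTE ne_p) mulr0.
Qed.

Lemma companion_top_mul_first u T a j :
  (forall i j, T i j = a (i%:Z - j%:Z)) ->
  (companion_top u *m T) ord0 j = recurrence_value u a (- 1 - j%:Z).
Proof.
move=> Ta; rewrite mxE /recurrence_value mulNr mulr_suml -sumrN.
(* The first row of the companion matrix lists the entries of [u] backwards. *)
rewrite (reindex_inj rev_ord_inj) /=; apply: eq_bigr => p _.
have := ltn_ord p => ltp.
rewrite !mxE eqxx Ta /= mulNr mulrAC subSS subKn //.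
by congr (- (_ * a _ / _)); lia.
Qed.

Lemma mul_companion_right_last u T a i :
  (forall i j, T i j = a (i%:Z - j%:Z)) ->
  (T *m companion_right u) i ord_max = recurrence_value u a (i%:Z - n.+1%:Z).
Proof.
move=> Ta; rewrite mxE /recurrence_value mulNr mulr_suml -sumrN.
apply: eq_bigr => p _; rewrite !mxE eqxx Ta mulrN mulrA [a _ * _]mulrC.
by congr (- (_ * a _ / _)); lia.
Qed.

(** Away from the corner [(0, n)] this is the fact that the inserted first row
    continues the diagonals of [T], thanks to [kernel_recurrence]. *)
Lemma companion_top_mul_col u T (j j' : 'I_n.+1) i :
    is_toeplitz T -> u ord_max ord0 != 0 -> dtoeplitz T *m u = 0 ->
  j' = j.+1 :> nat -> (companion_top u *m T) i j = T i j'.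
Proof.
move=> /toeplitz_coefE Ta u_last u_ker jj'; have := ltn_ord j' => ltj'.
have [i0|i_gt0] := posnP i.
  have -> : i = ord0 by apply: val_inj.
  rewrite (companion_top_mul_first _ _ Ta) (kernel_recurrence Ta) //; try lia.
  by rewrite Ta; congr toeplitz_coef; rewrite /=; lia.
have lti : (i.-1 < n.+1)%N by have := ltn_ord i; lia.
rewrite (@companion_top_mul_below _ _ _ (Ordinal lti)) /=; last by lia.
by rewrite !Ta; congr toeplitz_coef; rewrite /=; lia.
Qed.

(** Both products are [T] with its diagonals shifted by one.  At the corner
    [(0, n)], where the kernel gives no information, the two sides are the same
    recurrence value, at index [- n - 1]. *)
Lemma companion_intertwining u T :
    is_toeplitz T -> u ord_max ord0 != 0 -> dtoeplitz T *m u = 0 ->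
  companion_top u *m T = T *m companion_right u.
Proof.
move=> T_toep u_last u_ker; have Ta := toeplitz_coefE T_toep.
apply/matrixP => i j; have [ltj|gej] := ltnP j n.
  have ltj' : (j.+1 < n.+1)%N by [].
  rewrite (@mul_companion_right_before _ _ _ _ (Ordinal ltj')) //.
  exact: companion_top_mul_col.
have -> : j = ord_max by apply: val_inj; have := ltn_ord j; rewrite /=; lia.
rewrite (mul_companion_right_last _ _ Ta).
have [i0|i_gt0] := posnP i.
  have -> : i = ord0 by apply: val_inj.
  rewrite (companion_top_mul_first _ _ Ta).
  by congr recurrence_value; rewrite /=; lia.
have lti : (i.-1 < n.+1)%N by have := ltn_ord i; lia.
rewrite (@companion_top_mul_below _ _ _ (Ordinal lti)) /=; last by lia.
rewrite (kernel_recurrence Ta) //; try by have := ltn_ord i; lia.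
by rewrite Ta; congr toeplitz_coef; rewrite /=; lia.
Qed.

(** The last column has the single nonzero entry [- u_0 / u_(n+1)], at the top,
    so a row vector killed by the matrix has first entry zero; each of the other
    columns then kills one of the remaining entries. *)
Lemma companion_top_unit u :
    u ord0 ord0 != 0 -> u ord_max ord0 != 0 ->
  companion_top u \in unitmx.
Proof.
move=> u_first u_last; rewrite -row_free_unit; apply: inj_row_free => v vC0.
have vCj j : \sum_i v ord0 i * companion_top u i j = 0.
  by have /matrixP/(_ ord0 j) := vC0; rewrite !mxE.
have v0 : v ord0 ord0 = 0.
  have := vCj ord_max; rewrite big_ord_recl big1 => [|p _]; rewrite !mxE.
    rewrite eqxx subnn addr0 => /eqP; rewrite mulf_eq0 oppr_eq0 mulf_eq0 invr_eq0.
    have -> : inord 0 = ord0 :> 'I_n.+2 by apply: val_inj; rewrite /= inordK.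
    by rewrite (negbTE u_first) (negbTE u_last) !orbF => /eqP.
  by rewrite lift_eqF /= eqSS (ltn_eqF (ltn_ord p)) mulr0.
apply/rowP => i; rewrite [RHS]mxE.
have [i0|i_gt0] := posnP i; first by rewrite (_ : i = ord0) //; apply: val_inj.
have lti : (i.-1 < n.+1)%N by have := ltn_ord i; lia.
have := vCj (Ordinal lti); rewrite (bigD1 i) //= big1 => [|p ne_p].
  by rewrite !mxE -(inj_eq val_inj) /= prednK // eqxx eqn0Ngt i_gt0 mulr1 addr0.
have [->|p_neq0] := eqVneq p ord0; first by rewrite v0 mul0r.
by rewrite mxE (negbTE p_neq0) /= prednK // val_eqE (negbTE ne_p) mulr0.
Qed.

End Companion.

(** * Integer powers and the entries of the extension *)

Lemma intertwining_exprz (F : fieldType) (n : nat) (C D T : 'M[F]_n.+1) :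
    C \in unitmx -> D \in unitmx -> C *m T = T *m D ->
  forall z : int, C ^ z *m T = T *m D ^ z.
Proof.
rewrite !mulmxE => C_unit D_unit CT.
have CTn (m : nat) : C ^+ m * T = T * D ^+ m.
  by elim: m => [|m IH]; rewrite ?mul1r ?mulr1 // !exprS -mulrA IH mulrA CT mulrA.
case=> m; first exact: CTn.
have Cm_unit : C ^+ m.+1 \is a GRing.unit by rewrite unitrX.
have Dm_unit : D ^+ m.+1 \is a GRing.unit by rewrite unitrX.
rewrite !NegzE -!exprnN; apply: (mulrI Cm_unit).
by rewrite mulVKr // mulrA CTn mulrK.
Qed.

Section Orbit.
Variables (F : fieldType) (n : nat) (T : 'M[F]_n.+1) (u : 'cV[F]_n.+2).
Hypotheses (T_toep : is_toeplitz T) (T_unit : T \in unitmx).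
Hypotheses (u_first : u ord0 ord0 != 0) (u_last : u ord_max ord0 != 0).
Hypothesis u_ker : dtoeplitz T *m u = 0.

Let C_unit : companion_top u \in unitmx := companion_top_unit u_first u_last.

Lemma orbit_row (z : int) (i j : 'I_n.+1) :
  (companion_top u ^ z *m T) i j =
  (companion_top u ^ (z - i%:Z) *m T) ord0 j.
Proof.
elim: {i}(i : nat) {-2}i z (erefl (i : nat)) => [|m IH] i z im.
  by rewrite im subr0 (_ : i = ord0) //; apply: val_inj.
have ltm : (m < n.+1)%N by have := ltn_ord i; lia.
have zE : companion_top u ^ z = companion_top u *m companion_top u ^ (z - 1).
  by rewrite mulmxE -{2}[companion_top u]expr1z -exprzDr // subrKC.
rewrite zE -mulmxA.
rewrite (@companion_top_mul_below _ _ _ _ _ (Ordinal ltm)) //.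
have -> : z - i%:Z = z - 1 - m%:Z by rewrite im; lia.
exact: (IH (Ordinal ltm)).
Qed.

Lemma orbit_col (z : int) (i j : 'I_n.+1) :
  (companion_top u ^ z *m T) i j =
  (companion_top u ^ (z + j%:Z) *m T) i ord0.
Proof.
elim: {j}(j : nat) {-2}j z (erefl (j : nat)) => [|m IH] j z jm.
  by rewrite jm addr0 (_ : j = ord0) //; apply: val_inj.
have ltm : (m < n.+1)%N by have := ltn_ord j; lia.
have -> : z + j%:Z = z + 1 + m%:Z by rewrite jm; lia.
rewrite -(IH (Ordinal ltm)) // exprzDr // expr1z -mulmxE -mulmxA.
rewrite [LHS]mxE [RHS]mxE; apply: eq_bigr => p _; congr (_ * _).
by rewrite (companion_top_mul_col (j' := j)).
Qed.

(** This sequence, read backwards, prolongs the coefficients of [T] to all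
    integers: [a_d = orbit_entry (- d)] for [|d| <= n]. *)
Definition orbit_entry (z : int) : F := (companion_top u ^ z *m T) ord0 ord0.

Lemma orbit_entryE (z : int) (i j : 'I_n.+1) :
  (companion_top u ^ z *m T) i j = orbit_entry (z + j%:Z - i%:Z).
Proof. by rewrite orbit_row orbit_col addrAC. Qed.

(** By [orbit_row] the rows of the lower block are first rows too, for the
    exponents that continue downwards those of the upper block. *)
Lemma row_row_extension (k l : int) (i : 'I_(`|(k - l)%R|%N + n.+1)) :
  row i (row_extension u T k l) =
  row ord0 (companion_top u ^ (l + `|(k - l)%R|%N%:Z - i%:Z) *m T).
Proof.
apply/rowP => j; rewrite [LHS]mxE [RHS]mxE [LHS]mxE; case: splitP => p ip.
  rewrite [LHS]mxE [LHS]mxE ip.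
  suff -> : (`|(k - l)%R| - p)%N%:Z = `|(k - l)%R|%N%:Z - p%:Z by rewrite addrA.
  by have := ltn_ord p; lia.
rewrite orbit_row ip.
by have -> : l + `|(k - l)%R|%N%:Z - (`|(k - l)%R| + p)%N%:Z = l - p%:Z by lia.
Qed.

Lemma row_extension_mul_right (k l y : int) i j :
  (row_extension u T k l *m companion_right u ^ y) i j =
  orbit_entry (l + `|(k - l)%R|%N%:Z + y + j%:Z - i%:Z).
Proof.
have CT := companion_intertwining T_toep u_last u_ker.
(* [companion_right u] is conjugate to [companion_top u], hence a unit. *)
have D_unit : companion_right u \in unitmx.
  by have := unitmx_mul T (companion_right u); rewrite -CT unitmx_mul C_unit T_unit.
transitivity (row i (row_extension u T k l *m companion_right u ^ y) ord0 j).
  by rewrite [RHS]mxE.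
rewrite row_mul row_row_extension -row_mul mxE -mulmxA.
rewrite -(intertwining_exprz C_unit D_unit CT) mulmxA mulmxE -exprzDr //.
by rewrite -mulmxE orbit_entryE; congr orbit_entry; rewrite /=; lia.
Qed.

(** Column [q] of the appended right block is a last column, of index [n], at
    exponent [t + q + 1]: this is the exponent reached by going on past the
    left block, at column [n + 1 + q]. *)
Lemma extensionE (k l s t : int) i j :
  extension u T k l s t i j =
  orbit_entry (l + `|(k - l)%R|%N%:Z + t + j%:Z - i%:Z).
Proof.
rewrite [LHS]mxE; case: splitP => q jq; rewrite jq.
  exact: row_extension_mul_right.
rewrite [LHS]mxE row_extension_mul_right.
by congr orbit_entry; rewrite /=; lia.
Qed.

End Orbit.

Theorem theorem2p10 (R : realType) (n : nat) (T : 'M[R]_n.+1)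
    (u : 'cV[R]_n.+2)
    (T_toeplitz : is_toeplitz T) (T_unit : T \in unitmx)
    (u_first : u ord0 ord0 != 0) (u_last : u ord_max ord0 != 0)
    (u_ker : dtoeplitz T *m u = 0)
    (k l s t : int) (le_lk : l <= k) (le_ts : t <= s) :
  is_toeplitz (extension u T k l s t).
Proof.
move=> i i' j j' eq_diag; rewrite !extensionE //.
by congr orbit_entry; lia.
Qed.
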